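(* Let $S$ be a numerical semigroup and let $p(X_1,\dots,X_n)=\sum_{i=1}^n a_iX_i+a_0$ be a linear pattern admitted by the maximal ideal $M(S)$ of $S$. Then $p$ is an endopattern of $M(S)$ if and only if $a_0>0$ or $\sum_{i=1}^n a_i>\max(0,-a_0/m(S))$ (or both).
   Context: $\mathbb{Z}_+$ denotes the set of non-negative integers. A numerical semigroup is a subset of $\mathbb{Z}_+$ that contains $0$, is closed under addition and has finite complement in $\mathbb{Z}_+$. The maximal ideal $M(S)$ of $S$ is the set of non-zero elements of $S$, and the multiplicity $m(S)$ is the smallest element of $M(S)$. Linear patterns are polynomials $\sum_{i=1}^n a_iX_i+a_0$ with integer coefficients. Such $p$ is admitted by $M(S)$ if $p(s_1,\dots,s_n)\in S$ for every non-increasing sequence $s_1\ge\cdots\ge s_n$ of elements of $M(S)$, and is an endopattern of $M(S)$ if all these values lie in $M(S)$. *)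

(* Defs.v *)
From HB Require Import structures.
From mathcomp Require Export all_boot all_order all_algebra.
From mathcomp Require Export mpoly.

Set Implicit Arguments.
Unset Strict Implicit.
Unset Printing Implicit Defensive.

Import Order.TTheory GRing.Theory Num.Theory.

Local Open Scope nat_scope.

(* Finiteness of the complement: all the gaps occur in some finite list. *)
Record numericalSemigroup := NumericalSemigroup {
  nsg_pred :> {pred nat};
  nsg_0 : 0 \in nsg_pred;
  nsg_D : forall x y, x \in nsg_pred -> y \in nsg_pred -> x + y \in nsg_pred;
  nsg_cofinite :
    exists gaps : seq nat, forall x, x \notin nsg_pred -> x \in gaps
}.

Definition maximal_ideal (S : numericalSemigroup) : {pred nat} :=
  [pred x | (x != 0) && (x \in S)].

Lemma maximal_ideal_nonempty (S : numericalSemigroup) :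
  exists x, x \in maximal_ideal S.
Proof.
have [gaps gapsP] := nsg_cofinite S.
exists (sumn gaps).+1; rewrite inE /=.
have le_sumn z : z \in gaps -> z <= sumn gaps.
  elim: gaps {gapsP} => //= g t IHt; rewrite inE => /orP[/eqP-> | /IHt z_le].
    exact: leq_addr.
  exact: leq_trans z_le (leq_addl _ _).
by apply: contraT => /gapsP/le_sumn; rewrite ltnn.
Qed.

Definition multiplicity (S : numericalSemigroup) : nat :=
  ex_minn (maximal_ideal_nonempty S).

Local Open Scope ring_scope.

Definition linear_pattern (n : nat) (a : 'I_n -> int) (a0 : int) :
    {mpoly int[n]} :=
  (\sum_(i < n) a i *: 'X_i) + a0%:MP.

Definition nonincreasing_seq (n : nat) (s : 'I_n -> nat) : Prop :=
  forall i j : 'I_n, (i <= j)%N -> (s j <= s i)%N.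

Definition pattern_value (n : nat) (p : {mpoly int[n]}) (s : 'I_n -> nat) :
    int :=
  p.@[fun i => (s i)%:Z].

Definition admitted (S : numericalSemigroup) (n : nat) (p : {mpoly int[n]}) :
    Prop :=
  forall s : 'I_n -> nat,
    nonincreasing_seq s -> (forall i, s i \in maximal_ideal S) ->
    exists2 k : nat, k \in S & pattern_value p s = k%:Z.

Definition endopattern (S : numericalSemigroup) (n : nat) (p : {mpoly int[n]}) :
    Prop :=
  forall s : 'I_n -> nat,
    nonincreasing_seq s -> (forall i, s i \in maximal_ideal S) ->
    exists2 k : nat, k \in maximal_ideal S & pattern_value p s = k%:Z.

(* Main.v *)
Require Import Defs.
From mathcomp Require Import all_boot all_order all_algebra.
From mathcomp Require Import mpoly.
From mathcomp Require Import zify ring.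
Import Order.TTheory GRing.Theory Num.Theory.
Local Open Scope ring_scope.

(** Write [m] for the multiplicity of [S], [A] for the sum of the coefficients
    [a i] and [L s] for the homogeneous part [\sum_i a i * s i]. Because an
    admitted pattern takes values in [S], all of which are nonnegative, it is
    an endopattern exactly when it never vanishes.

    The key fact ([admitted_min_at_multiplicity]) is that the constant sequence
    [m] minimises the pattern: [A * m <= L s] for every admissible [s]. This
    could be read off from the nonnegativity of the partial sums of the
    coefficients by Abel summation, but a scaling argument gives it directly.
    The sequence [m + N * m * (s i - m)] is non-increasing and consists of
    nonzero multiples of [m], so the pattern is nonnegative on it; its value
    there is affine in [N] with slope [m * (L s - A * m)], and an affine
    function that is nonnegative on all natural numbers has a nonnegative slope
    ([affine_ge0_slope]). The same argument on the constant sequences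
    [(N + 1) * m] shows that [0 <= A].

    Hence the pattern is an endopattern if and only if [0 < A * m + a0], and
    given [0 <= A] this is the stated condition. *)

Lemma multiplicity_mem (S : numericalSemigroup) :
  multiplicity S \in maximal_ideal S.
Proof. by rewrite /multiplicity; case: ex_minnP. Qed.

Lemma multiplicity_le (S : numericalSemigroup) x :
  x \in maximal_ideal S -> (multiplicity S <= x)%N.
Proof. by rewrite /multiplicity; case: ex_minnP => m _; apply. Qed.

Lemma multiplicity_gt0 (S : numericalSemigroup) : (0 < multiplicity S)%N.
Proof. by have := multiplicity_mem S; rewrite inE lt0n => /andP[]. Qed.

Lemma nsg_mull (S : numericalSemigroup) k x : x \in S -> (k * x)%N \in S.
Proof.
by move=> Sx; elim: k => [|k IHk]; rewrite ?nsg_0 // mulSn nsg_D.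
Qed.

Lemma maximal_ideal_mull (S : numericalSemigroup) k x :
  (0 < k)%N -> x \in maximal_ideal S -> (k * x)%N \in maximal_ideal S.
Proof.
rewrite !inE -!lt0n muln_gt0 => -> /andP[-> Sx] /=.
exact: nsg_mull.
Qed.

Lemma pattern_value_linear n (a : 'I_n -> int) (a0 : int) (s : 'I_n -> nat) :
  pattern_value (linear_pattern a a0) s = \sum_i a i * (s i)%:Z + a0.
Proof.
rewrite /pattern_value /linear_pattern mevalD mevalC raddf_sum /=.
by congr (_ + _); apply: eq_bigr => i _; rewrite mevalZ mevalXU.
Qed.

Lemma affine_ge0_slope (b d : int) :
  (forall N : nat, 0 <= b + N%:Z * d) -> 0 <= d.
Proof.
move=> ge0; rewrite leNgt; apply/negP => d_lt0.
have := ge0 `|b|.+1; nia.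
Qed.

Lemma admitted_ge0 (S : numericalSemigroup) (n : nat)
    (a : 'I_n -> int) (a0 : int) (s : 'I_n -> nat) :
  admitted S (linear_pattern a a0) ->
  nonincreasing_seq s -> (forall i, s i \in maximal_ideal S) ->
  0 <= \sum_i a i * (s i)%:Z + a0.
Proof.
move=> adm s_dec sM; have [k _] := adm s s_dec sM.
by rewrite pattern_value_linear => ->.
Qed.

Lemma admitted_sum_ge0 (S : numericalSemigroup) (n : nat)
    (a : 'I_n -> int) (a0 : int) :
  admitted S (linear_pattern a a0) -> 0 <= \sum_i a i.
Proof.
move=> adm; set m := multiplicity S; set A := \sum_i a i.
have m_gt0 : 0 < m%:Z by rewrite ltz_nat multiplicity_gt0.
rewrite -(pmulr_lge0 _ m_gt0).
apply: (affine_ge0_slope (A * m%:Z + a0)) => N.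
have := admitted_ge0 _ _ _ _ (fun=> (N.+1 * m)%N) adm.
rewrite -mulr_suml -/A => /(_ (fun _ _ _ => leqnn _)).
move=> /(_ (fun=> maximal_ideal_mull _ _ _ (ltn0Sn N) (multiplicity_mem S))).
by congr (0 <= _); rewrite PoszM -addn1 PoszD; ring.
Qed.

(** Pushing [s] away from the constant sequence [m], by the factor [N * m], keeps
    it non-increasing and inside the maximal ideal whatever the gaps of [S] are,
    since all the new entries are multiples of [m]. Nonnegativity of the pattern
    for every [N] then forces it not to decrease in this direction. *)
Lemma admitted_min_at_multiplicity (S : numericalSemigroup) (n : nat)
    (a : 'I_n -> int) (a0 : int) (s : 'I_n -> nat) :
  admitted S (linear_pattern a a0) ->
  nonincreasing_seq s -> (forall i, s i \in maximal_ideal S) ->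
  (\sum_i a i) * (multiplicity S)%:Z <= \sum_i a i * (s i)%:Z.
Proof.
move=> adm s_dec sM; set m := multiplicity S; set A := \sum_i a i.
have m_gt0 : 0 < m%:Z by rewrite ltz_nat multiplicity_gt0.
rewrite -subr_ge0 -(pmulr_lge0 _ m_gt0).
apply: (affine_ge0_slope (A * m%:Z + a0)) => N.
have := admitted_ge0 _ _ _ _ (fun i => (N * (s i - m)).+1 * m)%N adm.
have -> : \sum_i a i * ((N * (s i - m)).+1 * m)%N%:Z + a0 =
    A * m%:Z + a0 + N%:Z * ((\sum_i a i * (s i)%:Z - A * m%:Z) * m%:Z).
  rewrite /A !mulr_suml -sumrB mulr_suml mulr_sumr addrAC -big_split /=.
  congr (_ + _); apply: eq_bigr => i _.
  (* No truncation occurs in [s i - m], as [m] is the least element of [M(S)]. *)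
  rewrite PoszM -addn1 PoszD PoszM -subzn ?multiplicity_le //; ring.
apply=> [i j /s_dec le_s | i].
  by rewrite leq_mul2r ltnS leq_mul2l leq_sub2r ?orbT.
exact: maximal_ideal_mull (multiplicity_mem S).
Qed.

(** Being an endopattern is decided by a single value of the pattern, the least
    one, taken on the constant sequence of the multiplicity. *)
Lemma endopattern_iff_multiplicity (S : numericalSemigroup) (n : nat)
    (a : 'I_n -> int) (a0 : int) :
  admitted S (linear_pattern a a0) ->
  endopattern S (linear_pattern a a0) <->
  0 < (\sum_i a i) * (multiplicity S)%:Z + a0.
Proof.
move=> adm; split=> [endo | pos s s_dec sM].
  have [|k] := endo (fun=> multiplicity S) (fun _ _ _ => leqnn _).
    by move=> _; exact: multiplicity_mem.
  rewrite pattern_value_linear -mulr_suml inE => /andP[k_neq0 _] ->.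
  by rewrite ltz_nat lt0n.
have [k Sk def_k] := adm s s_dec sM; exists k => //.
rewrite inE /= Sk andbT -lt0n -ltz_nat -def_k pattern_value_linear.
by rewrite (lt_le_trans pos) // lerD2r (admitted_min_at_multiplicity _ _ _ a0).
Qed.

Theorem proposition19 (S : numericalSemigroup) (n : nat)
    (a : 'I_n -> int) (a0 : int)
    (adm : admitted S (linear_pattern a a0)) :
  endopattern S (linear_pattern a a0) <->
  (0 < a0 \/
   Num.max (0 : rat) (- a0%:~R / (multiplicity S)%:R)
     < (\sum_(i < n) a i)%:~R).
Proof.
rewrite (endopattern_iff_multiplicity _ _ _ _ adm).
have A_ge0 := admitted_sum_ge0 _ _ _ _ adm.
have m_gt0 := multiplicity_gt0 S.
rewrite gt_max ltr0z ltr_pdivrMr ?ltr0n //.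
rewrite pmulrn -rmorphM -rmorphN ltr_int /=.
move: (\sum_i a i) (multiplicity S) A_ge0 m_gt0 => A m A_ge0 m_gt0.
split=> [pos | [a0_gt0 | /andP[_]]]; last by lia.
  case: (ltrP 0 a0) => [|a0_le0]; [by left | right].
  by apply/andP; split; nia.
nia.
Qed.
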